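(* Let $k\ge 3$. Every $\{0,1\}$-constructable $k$-hypergraph is $T2$-threshold, and it is also $T3$-threshold. In particular, every antiregular $k$-hypergraph is $T2$-threshold and $T3$-threshold.
   Context: A $k$-hypergraph is a hypergraph all of whose hyperedges have exactly $k$ vertices. A $k$-hypergraph is $\{0,1\}$-constructable if it can be built, starting from the empty hypergraph, by repeatedly adding either an isolated vertex (no new hyperedges) or a dominating vertex $v$ (adding as hyperedges all sets $\{v\}\cup S$ with $S$ a $(k-1)$-subset of the vertices already present), in some order. Antiregular $k$-hypergraphs are those built by first adding $k-1$ isolated vertices and then alternately adding isolated and dominating vertices (starting with either kind). A $k$-hypergraph $H=(V,E)$ is $T2$-threshold if there exist a labeling $c:V\to\mathbb{R}$ and a threshold $\tau$ such that for every $k$-element subset $X\subseteq V$, $X\in E$ iff $\sum_{x\in X}c(x)>\tau$. For $x,y\in V$ write $x\ll y$ if for every $(k-1)$-element subset $S\subseteq V\setminus\{x,y\}$, $S\cup\{x\}\in E$ implies $S\cup\{y\}\in E$; $H$ is $T3$-threshold if for all $x,y\in V$, $x\ll y$ or $y\ll x$ (or both). *)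

(* Defs.v *)
From mathcomp Require Import all_boot all_order all_algebra.
From mathcomp Require Import reals.
Set Implicit Arguments.
Unset Strict Implicit.
Unset Printing Implicit Defensive.
Import Order.TTheory GRing.Theory Num.Theory.

(* The vertex set is an explicit subset of an ambient finite type, so that the
   successive stages of a construction are hypergraphs over the same type. *)
Record hypergraph (T : finType) := Hypergraph {
  vset : {set T};
  eset : {set {set T}};
  eset_sub : eset \subset powerset vset
}.

Definition khypergraph (k : nat) (T : finType) (H : hypergraph T) : bool :=
  [forall e in eset H, #|e| == k].

Definition empty_hypergraph (T : finType) : hypergraph T :=
  Hypergraph (sub0set (powerset (@set0 T))).

Lemma add_isolated_sub (T : finType) (v : T) (H : hypergraph T) :
  eset H \subset powerset (v |: vset H).
Proof. by apply: subset_trans (eset_sub H) _; rewrite powersetS subsetUr. Qed.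

Definition add_isolated (T : finType) (v : T) (H : hypergraph T) :
  hypergraph T := Hypergraph (add_isolated_sub v H).

Definition dominating_edges (k : nat) (T : finType) (v : T)
    (H : hypergraph T) : {set {set T}} :=
  [set v |: S | S : {set T} in powerset (vset H) & #|S| == k.-1].

Lemma add_dominating_sub (k : nat) (T : finType) (v : T) (H : hypergraph T) :
  eset H :|: dominating_edges k v H \subset powerset (v |: vset H).
Proof.
rewrite subUset add_isolated_sub /=; apply/subsetP => e /imsetP[S].
by rewrite inE powersetE => /andP[sSV _] ->; rewrite powersetE setUS.
Qed.

Definition add_dominating (k : nat) (T : finType) (v : T)
    (H : hypergraph T) : hypergraph T :=
  Hypergraph (add_dominating_sub k v H).

(* A step (v, b) adds the vertex v, isolated if b = false (0) and dominating
   if b = true (1); the head of the sequence is the first step performed. *)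
Definition add_vertex (k : nat) (T : finType) (H : hypergraph T)
    (s : T * bool) : hypergraph T :=
  if s.2 then add_dominating k s.1 H else add_isolated s.1 H.

Definition build (k : nat) (T : finType) (s : seq (T * bool)) : hypergraph T :=
  foldl (@add_vertex k T) (empty_hypergraph T) s.

(* [uniq (unzip1 s)] says that each step adds a vertex not already present. *)
Definition constructable (k : nat) (T : finType) (H : hypergraph T) : Prop :=
  exists2 s : seq (T * bool), uniq (unzip1 s) & H = build k s.

Definition alternating (t : seq bool) : bool :=
  sorted (fun a b : bool => a != b) t.

Definition antiregular (k : nat) (T : finType) (H : hypergraph T) : Prop :=
  exists (s : seq (T * bool)) (t : seq bool),
    [/\ uniq (unzip1 s), H = build k s,
        unzip2 s = nseq k.-1 false ++ t & alternating t].

Definition T2_threshold (R : realType) (k : nat) (T : finType)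
    (H : hypergraph T) : Prop :=
  exists (c : T -> R) (tau : R), forall X : {set T},
    X \subset vset H -> #|X| = k ->
    (X \in eset H <-> (tau < \sum_(x in X) c x)%R).

Definition vertex_le (k : nat) (T : finType) (H : hypergraph T) (x y : T) :
    Prop :=
  forall S : {set T}, S \subset vset H :\: [set x; y] -> #|S| = k.-1 ->
    x |: S \in eset H -> y |: S \in eset H.

Definition T3_threshold (k : nat) (T : finType) (H : hypergraph T) : Prop :=
  forall x y : T, x \in vset H -> y \in vset H ->
    vertex_le k H x y \/ vertex_le k H y x.

(* Main.v *)
(* Each new vertex gets a weight, positive if dominating and negative if
   isolated, whose absolute value exceeds the total absolute weight of the
   earlier vertices.  The sign of the weight of a k-set is then decided by the
   latest vertex in it, as is being an edge, so the threshold 0 works.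
   Comparing labels then turns T2 into T3. *)
Require Import Defs.
From mathcomp Require Import all_boot all_order all_algebra.
From mathcomp Require Import reals.
From mathcomp Require Import lra.

Set Implicit Arguments.
Unset Strict Implicit.
Unset Printing Implicit Defensive.
Import Order.TTheory GRing.Theory Num.Theory.
Local Open Scope ring_scope.

(** T2 with the threshold pinned at 0, so that only the sign of a sum matters; this form passes from
    one construction stage to the next. *)
Definition threshold0 (R : realType) (k : nat) (T : finType)
    (H : hypergraph T) (c : T -> R) : Prop :=
  forall X : {set T}, X \subset vset H -> #|X| = k ->
    (X \in eset H) = (0 < \sum_(x in X) c x).

Lemma vset_add_vertex (k : nat) (T : finType) (H : hypergraph T) v b :
  vset (add_vertex k H (v, b)) = v |: vset H.
Proof. by case: b. Qed.

Lemma vset_build (k : nat) (T : finType) (s : seq (T * bool)) :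
  vset (build k s) = [set:: unzip1 s].
Proof.
elim/last_ind: s => [|s [v b] IHs].
  by apply/setP => x; rewrite !inE.
rewrite /build foldl_rcons vset_add_vertex -/(build k s) IHs.
by apply/setP => x; rewrite !inE /unzip1 map_rcons mem_rcons inE.
Qed.

Lemma mem_edge_subset (T : finType) (H : hypergraph T) (X : {set T}) :
  X \in eset H -> X \subset vset H.
Proof. by move=> XE; rewrite -powersetE (subsetP (eset_sub H)). Qed.

(** Every hyperedge created by adding [v] contains [v]. *)
Lemma mem_add_vertex_old (k : nat) (T : finType) (H : hypergraph T) v b
    (X : {set T}) :
  v \notin X -> (X \in eset (add_vertex k H (v, b))) = (X \in eset H).
Proof.
move=> vX; case: b => //=; rewrite in_setU orbC.
by case: imsetP => // -[S _ XvS]; rewrite XvS setU11 in vX.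
Qed.

Lemma mem_add_vertex_new (k : nat) (T : finType) (H : hypergraph T) v b
    (X : {set T}) :
    v \notin vset H -> v \in X -> X \subset v |: vset H -> #|X| = k ->
  (X \in eset (add_vertex k H (v, b))) = b.
Proof.
move=> vH vX XvH cardX.
case: b => /=.
  rewrite in_setU; apply/orP; right.
  apply/imsetP; exists (X :\ v); last by rewrite setD1K.
  by rewrite inE powersetE subDset XvH -cardX (cardsD1 v X) vX /=.
(* Isolated case: a hyperedge of [H] containing [v] would put [v] in [vset H]. *)
by apply: contraNF vH => /mem_edge_subset/subsetP; apply.
Qed.

Lemma threshold0_add_vertex (R : realType) (k : nat) (T : finType)
    (H : hypergraph T) v b (c : T -> R) :
    v \notin vset H -> threshold0 k H c ->
  exists c' : T -> R, threshold0 k (add_vertex k H (v, b)) c'.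
Proof.
move=> vH cH.
(* The summand 1 makes [M] strictly larger than any partial sum of old labels in absolute value. *)
pose M : R := 1 + \sum_(x in vset H) `|c x|.
pose c' x : R := if x == v then if b then M else - M else c x.
have c'E (A : {set T}) : v \notin A -> \sum_(x in A) c' x = \sum_(x in A) c x.
  move=> vA; apply: eq_bigr => x xA; rewrite /c'.
  by case: eqP => // xv; rewrite -xv xA in vA.
exists c' => X; rewrite vset_add_vertex => XvH cardX.
have [vX | vX] := boolP (v \in X); last first.
  have XH : X \subset vset H.
    apply/subsetP => x xX; have /setU1P[xv|//] := subsetP XvH x xX.
    by rewrite -xv xX in vX.
  by rewrite mem_add_vertex_old // c'E // cH.
rewrite mem_add_vertex_new // (big_setD1 v) //= c'E ?setD11 // {1}/c' eqxx.
have rest_lt : `|\sum_(x in X :\ v) c x| < M.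
  apply: le_lt_trans (ler_norm_sum _ _ _) _.
  have XDv : X :\ v \subset vset H by rewrite subDset.
  rewrite /M [sumH in 1 + sumH](big_setID (X :\ v)) /= (setIidPr XDv).
  have : 0 <= \sum_(x in vset H :\: (X :\ v)) `|c x| by apply: sumr_ge0.
  lra.
have /andP[] : - M < \sum_(x in X :\ v) c x < M by rewrite -ltr_norml.
(* The old labels in [X] sum to less than [M] in absolute value, so the label [M] or [- M] of [v]
   fixes the sign. *)
by case: b {c' c'E} => ? ?; apply/esym; [|apply/negbTE; rewrite -leNgt]; lra.
Qed.

(** Induction from the end of [s], because the last step is the outermost one in [build]; [uniq]
    makes its vertex fresh. *)
Lemma threshold0_build (R : realType) (k : nat) (T : finType)
    (s : seq (T * bool)) :
  uniq (unzip1 s) -> exists c : T -> R, threshold0 k (build k s) c.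
Proof.
elim/last_ind: s => [|s [v b] IHs].
  (* Only the empty set can occur: it is not a hyperedge, and its sum 0 is not positive. *)
  move=> _; exists (fun=> 0) => X; rewrite subset0 => /eqP-> _.
  by rewrite big_set0 ltxx inE.
rewrite /unzip1 map_rcons rcons_uniq => /andP[vs /IHs[c cs]].
rewrite /build foldl_rcons.
by apply: threshold0_add_vertex cs; rewrite vset_build inE.
Qed.

Lemma constructable_T2 (R : realType) (k : nat) (T : finType)
    (H : hypergraph T) :
  constructable k H -> T2_threshold R k H.
Proof.
case=> s /(threshold0_build R k)[c cs] ->.
by exists c, 0 => X XV cardX; rewrite cs.
Qed.

(** Exchanging [x] for a vertex [y] with at least as large a label cannot lower the sum, and labels
    are totally ordered. *)
Lemma T2_T3 (R : realType) (k : nat) (T : finType) (H : hypergraph T) :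
  (0 < k)%N -> T2_threshold R k H -> T3_threshold k H.
Proof.
move=> k_gt0 [c [tau cH]].
have le_vertex x y : x \in vset H -> y \in vset H -> c x <= c y ->
    vertex_le k H x y.
  move=> xH yH cxy S; rewrite subsetD => /andP[SH].
  rewrite disjoint_sym disjoints_subset => /subsetP xyS cardS.
  have notinS z : z \in [set x; y] -> z \notin S by move/xyS; rewrite inE.
  have xS : x \notin S by rewrite notinS ?set21.
  have yS : y \notin S by rewrite notinS ?set22.
  have card_new z : z \notin S -> #|z |: S| = k.
    (* Positivity of [k] enters here, as [k.-1] is truncated at 0. *)
    by move=> zS; rewrite cardsU1 zS cardS add1n prednK.
  have sub_new z : z \in vset H -> z |: S \subset vset H.
    by move=> zH; rewrite subUset sub1set zH.
  move/cH => /(_ (sub_new _ xH) (card_new _ xS)) lt_x.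
  apply/cH; [exact: sub_new | exact: card_new |].
  by apply: lt_le_trans lt_x _; rewrite !big_setU1 //= lerD2r.
move=> x y xH yH.
by have [/ltW cxy|cyx] := ltP (c x) (c y); [left|right]; apply: le_vertex.
Qed.

Lemma antiregular_constructable (k : nat) (T : finType) (H : hypergraph T) :
  antiregular k H -> constructable k H.
Proof. by case=> s [t [uniq_s -> _ _]]; exists s. Qed.

Local Close Scope ring_scope.

Theorem theorem4p3 (R : realType) (k : nat) (hk : 3 <= k) (T : finType)
    (H : hypergraph T) (hH : khypergraph k H) :
  (constructable k H -> T2_threshold R k H /\ T3_threshold k H) /\
  (antiregular k H -> T2_threshold R k H /\ T3_threshold k H).
Proof.
have T23 : constructable k H -> T2_threshold R k H /\ T3_threshold k H.
  move/(constructable_T2 R) => T2H; split=> //.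
  exact: T2_T3 (leq_trans _ hk) T2H.
by split=> [|/antiregular_constructable].
Qed.
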